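(* Let $N_1,N_2\in\mathbb{N}$, $\tau\in\mathbb{N}_0$. For $i\in\{1,\ldots,N_1\}$ and $j\in\{1,\ldots,N_2\}$ let $\hat c_i,\tilde c_j:\mathbb{N}_0\to(-1,1)$ be functions, let $\hat a_{ij},\tilde a_{ji},\hat b_{ij},\tilde b_{ji}:\mathbb{N}_0\to\mathbb{R}$ and $\hat\tau_{ij},\tilde\tau_{ji}:\mathbb{N}_0\to\mathbb{N}_0$ be bounded functions, let $\hat I_i,\tilde I_j:\mathbb{N}_0\to\mathbb{R}$ be functions, and let $f_j,g_i:\mathbb{R}\to\mathbb{R}$ be Lipschitz functions with Lipschitz constants $F_j$ and $G_i$, respectively. Consider the model $$\begin{cases}x_i(m+1)=\hat c_i(m)x_i(m-\tau)+\sum_{j=1}^{N_2}\hat a_{ij}(m)f_j(y_j(m))+\sum_{j=1}^{N_2}\hat b_{ij}(m)f_j(y_j(m-\hat\tau_{ij}(m)))+\hat I_i(m),& i=1,\ldots,N_1,\\[4pt] y_j(m+1)=\tilde c_j(m)y_j(m-\tau)+\sum_{i=1}^{N_1}\tilde a_{ji}(m)g_i(x_i(m))+\sum_{i=1}^{N_1}\tilde b_{ji}(m)g_i(x_i(m-\tilde\tau_{ji}(m)))+\tilde I_j(m),& j=1,\ldots,N_2,\end{cases}$$ for $m\in\mathbb{N}_0$. For each function $\phi$ among $\hat c_i,\tilde c_j,\hat a_{ij},\tilde a_{ji},\hat b_{ij},\tilde b_{ji}$ write $\phi^+=\sup_{m\in\mathbb{N}_0}|\phi(m)|$, and define $$\mathcal{P}=\begin{bmatrix}\mathcal{I}_{N_1}-\hat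 C&-U\\-S&\mathcal{I}_{N_2}-\tilde C\end{bmatrix},$$ where $\mathcal{I}_{N_k}$ is the $N_k\times N_k$ identity matrix ($k=1,2$), $\hat C=\mathrm{diag}(\hat c_1^+,\ldots,\hat c_{N_1}^+)$, $\tilde C=\mathrm{diag}(\tilde c_1^+,\ldots,\tilde c_{N_2}^+)$, $U$ is the $N_1\times N_2$ matrix with $(i,j)$ entry $(\hat a_{ij}^++\hat b_{ij}^+)F_j$, and $S$ is the $N_2\times N_1$ matrix with $(j,i)$ entry $(\tilde a_{ji}^++\tilde b_{ji}^+)G_i$. If $\mathcal{P}$ is a non-singular M-matrix, then the model is globally exponentially stable.
   Context: $\mathbb{N}=\{1,2,\ldots\}$, $\mathbb{N}_0=\mathbb{N}\cup\{0\}$. Put $N=N_1+N_2$ and $r=-\max_{i,j,m}\{\hat\tau_{ij}(m),\tilde\tau_{ji}(m),\tau\}$ (maximum over all indices and all $m\in\mathbb{N}_0$). For $I\subseteq\mathbb{R}$, $I_{\mathbb{Z}}=I\cap\mathbb{Z}$. $X$ is the space of functions $\alpha:[r,0]_{\mathbb{Z}}\to\mathbb{R}$ with norm $\|\alpha\|=\max_{l=r,\ldots,0}|\alpha(l)|$. $X^N$ carries the norm $\|\overline\alpha\|=\max_{i=1,\ldots,N}\|\alpha_i\|$. A solution is written $\overline{z}=(x_1,\ldots,x_{N_1},y_1,\ldots,y_{N_2}):[r,+\infty)_{\mathbb{Z}}\to\mathbb{R}^N$, and $\overline{z}_m\in X^N$ is defined by $\overline{z}_m(l)=\overline{z}(m+l)$,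 $l=r,\ldots,0$. For $\overline\alpha\in X^N$, $\overline{z}(\cdot,\overline\alpha)$ is the unique solution with $\overline{z}_0=\overline\alpha$, and $\overline{z}_m(\cdot,\overline\alpha)$ is its segment at time $m$. The model is globally exponentially stable if there are $C>0$ and $\zeta\in(0,1)$ such that $\|\overline{z}_m(\cdot,\overline\alpha)-\overline{z}_m(\cdot,\overline\beta)\|\le C\zeta^m\|\overline\alpha-\overline\beta\|$ for all $\overline\alpha,\overline\beta\in X^N$ and $m\in\mathbb{N}_0$. A non-singular M-matrix is a real square matrix with non-positive off-diagonal entries all of whose eigenvalues have positive real part (equivalently, with all principal minors positive). *)

(* Defs.v *)
From HB Require Import structures.
From mathcomp Require Import all_boot all_order all_algebra.
From mathcomp Require Import all_classical all_reals all_analysis.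
From mathcomp Require Import complex zify.
Set Implicit Arguments.
Unset Strict Implicit.
Unset Printing Implicit Defensive.
Import Order.TTheory GRing.Theory Num.Theory numFieldNormedType.Exports.
Local Open Scope classical_set_scope.
Local Open Scope ring_scope.

(* The prefixes h and t stand for hat and tilde.  The doubly indexed tilde
   coefficients take the index j of the y-layer first, as in a~_{ji}. *)
Record bam (R : realType) (N1 N2 : nat) := Bam {
  tau : nat;
  hc : 'I_N1 -> nat -> R;
  tc : 'I_N2 -> nat -> R;
  ha : 'I_N1 -> 'I_N2 -> nat -> R;
  ta : 'I_N2 -> 'I_N1 -> nat -> R;
  hb : 'I_N1 -> 'I_N2 -> nat -> R;
  tb : 'I_N2 -> 'I_N1 -> nat -> R;
  htau : 'I_N1 -> 'I_N2 -> nat -> nat;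
  ttau : 'I_N2 -> 'I_N1 -> nat -> nat;
  hI : 'I_N1 -> nat -> R;
  tI : 'I_N2 -> nat -> R;
  f_ : 'I_N2 -> R -> R;
  g_ : 'I_N1 -> R -> R
}.

Section Model.
Variables (R : realType) (N1 N2 : nat) (p : bam R N1 N2).

Definition delays : set nat :=
  [set tau p] `|`
  \bigcup_(ij in [set: 'I_N1 * 'I_N2])
     (range (htau p ij.1 ij.2) `|` range (ttau p ij.2 ij.1)).

(* For bounded delays this is the maximum of [delays], i.e. - r. *)
Definition max_delay : nat := supremum 0%N delays.

(* Column k of a history holds the values at time l = - k, for
   l = r, ..., 0.  The library norm `|alpha| is the maximum of the absolute
   values of the entries, i.e. max_i max_l |alpha_i(l)|. *)
Definition history := 'M[R]_(N1 + N2, max_delay.+1).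

(* Trajectories are total on the integers; their values before time r are
   irrelevant. *)
Definition trajectory := int -> 'cV[R]_(N1 + N2).

Definition xc (z : trajectory) (i : 'I_N1) (l : int) : R :=
  z l (lshift N2 i) 0.
Definition yc (z : trajectory) (j : 'I_N2) (l : int) : R :=
  z l (rshift N1 j) 0.

Definition segment (z : trajectory) (m : nat) : history :=
  \matrix_(i, k) z (m%:Z - k%:Z) i 0.

Definition x_next (z : trajectory) (i : 'I_N1) (m : nat) : R :=
  hc p i m * xc z i (m%:Z - (tau p)%:Z)
  + \sum_(j < N2) ha p i j m * f_ p j (yc z j m%:Z)
  + \sum_(j < N2) hb p i j m * f_ p j (yc z j (m%:Z - (htau p i j m)%:Z))
  + hI p i m.

Definition y_next (z : trajectory) (j : 'I_N2) (m : nat) : R :=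
  tc p j m * yc z j (m%:Z - (tau p)%:Z)
  + \sum_(i < N1) ta p j i m * g_ p i (xc z i m%:Z)
  + \sum_(i < N1) tb p j i m * g_ p i (xc z i (m%:Z - (ttau p j i m)%:Z))
  + tI p j m.

Definition is_solution (z : trajectory) : Prop :=
  forall m : nat,
    (forall i, xc z i (m%:Z + 1) = x_next z i m) /\
    (forall j, yc z j (m%:Z + 1) = y_next z j m).

Definition solution_from (alpha : history) (z : trajectory) : Prop :=
  is_solution z /\ segment z 0 = alpha.

(* z and w are the solutions z(., alpha) and z(., beta), which exist and are
   unique on [r, +oo): see [solution_from_ex] and [solution_from_uniq]. *)
Definition globally_exponentially_stable : Prop :=
  exists C zeta : R, [/\ 0 < C, 0 < zeta, zeta < 1 &
    forall (alpha beta : history) (z w : trajectory),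
      solution_from alpha z -> solution_from beta w ->
      forall m : nat,
        `|segment z m - segment w m| <= C * zeta ^+ m * `|alpha - beta|].

Definition delays_bounded : Prop :=
  forall i j, has_ubound (range (htau p i j)) /\ has_ubound (range (ttau p j i)).

Definition abs_sup (phi : nat -> R) : R := sup (range (fun m => `|phi m|)).

Definition bam_mx (F : 'I_N2 -> R) (G : 'I_N1 -> R) : 'M[R]_(N1 + N2) :=
  block_mx
    (1%:M - diag_mx (\row_i abs_sup (hc p i)))
    (- \matrix_(i, j) ((abs_sup (ha p i j) + abs_sup (hb p i j)) * F j))
    (- \matrix_(j, i) ((abs_sup (ta p j i) + abs_sup (tb p j i)) * G i))
    (1%:M - diag_mx (\row_j abs_sup (tc p j))).

End Model.

Definition nonsingular_M_matrix (R : realType) (n : nat) (A : 'M[R]_n) : Prop :=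
  (forall i j, i != j -> A i j <= 0) /\
  (forall z : R[i], eigenvalue (map_mx (real_complex R) A) z ->
     0 < complex.Re z).

Section Facts.
Variables (R : realType) (N1 N2 : nat) (p : bam R N1 N2).

Lemma max_delayP : delays_bounded p ->
  delays p (max_delay p) /\
  (forall n, delays p n -> (n <= max_delay p)%N).
Proof.
move=> bnd.
have dtau : delays p (tau p) by left.
have [M ubM] : exists M : nat, forall n, delays p n -> (n <= M)%N.
  have bnd' (ij : 'I_N1 * 'I_N2) : {M : nat | forall m,
      (htau p ij.1 ij.2 m <= M)%N /\ (ttau p ij.2 ij.1 m <= M)%N}.
    apply: cid; have [[M1 h1] [M2 h2]] := bnd ij.1 ij.2.
    exists (maxn M1 M2) => m; rewrite !leq_max; split; apply/orP.
      by left; have /= := h1 _ (imageT _ m); rewrite leEnat.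
    by right; have /= := h2 _ (imageT _ m); rewrite leEnat.
  exists (maxn (tau p) (\max_ij sval (bnd' ij))) => n.
  have le_sup ij : (sval (bnd' ij) <= \max_ij sval (bnd' ij))%N.
    by apply: (leq_bigmax (F := fun ij => sval (bnd' ij))).
  case=> [->|[ij _ hn]]; rewrite leq_max; first by rewrite leqnn.
  apply/orP; right; apply: leq_trans (le_sup ij).
  by have h := svalP (bnd' ij); case: hn => -[m _ <-]; have [] := h m.
have exd : exists n, `[< delays p n >] by exists (tau p); apply/asboolP.
have ubd n : `[< delays p n >] -> (n <= M)%N by move/asboolP/ubM.
have [d /asboolP dd ud] := ex_maxnP exd ubd.
have md n : delays p n -> (n <= d)%N by move=> h; apply: ud; apply/asboolP.
have supd : supremums (delays p) d.
  by split=> [n /md|n /(_ _ dd)//]; rewrite leEnat.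
suff -> : max_delay p = d by [].
rewrite /max_delay /supremum; case: ifPn => [/eqP E|_].
  by move: dtau; rewrite E.
case: xgetP => [e _ [ue le]|/(_ d)//].
have := ue _ dd; have := le _ supd.1; rewrite !leEnat => h1 h2.
by apply/eqP; rewrite eqn_leq h1 h2.
Qed.

Let next_ext (z w : trajectory R N1 N2) (m : nat) :
  z m%:Z = w m%:Z ->
  z (m%:Z - (tau p)%:Z) = w (m%:Z - (tau p)%:Z) ->
  (forall i j, z (m%:Z - (htau p i j m)%:Z) = w (m%:Z - (htau p i j m)%:Z)) ->
  (forall i j, z (m%:Z - (ttau p j i m)%:Z) = w (m%:Z - (ttau p j i m)%:Z)) ->
  (forall i, x_next p z i m = x_next p w i m) /\
  (forall j, y_next p z j m = y_next p w j m).
Proof.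
move=> z0 zt zh ztt; split=> [i|j].
  rewrite /x_next /xc /yc z0 zt; congr (_ + _ + _ + _).
  by apply: eq_bigr => j _; rewrite zh.
rewrite /y_next /xc /yc z0 zt; congr (_ + _ + _ + _).
by apply: eq_bigr => i _; rewrite ztt.
Qed.

Lemma solution_from_uniq (alpha : history p) (z w : trajectory R N1 N2) :
  delays_bounded p -> solution_from alpha z -> solution_from alpha w ->
  forall l : int, - (max_delay p)%:Z <= l -> z l = w l.
Proof.
move=> /max_delayP[_ ub] [solz z0] [solw w0].
have ini (k : nat) : (k <= max_delay p)%N -> z (- k%:Z) = w (- k%:Z).
  rewrite -ltnS => kd; apply/colP => i.
  have : segment p z 0 i (Ordinal kd) = segment p w 0 i (Ordinal kd).
    by rewrite z0 w0.
  by rewrite !mxE /= sub0r.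
have past (n : nat) : forall l : int, - (max_delay p)%:Z <= l -> l <= n%:Z ->
    z l = w l.
  elim: n => [|n IH] l ld ln.
    have -> : l = - `|l|%N%:Z by lia.
    by apply: ini; lia.
  have [ln'|nl] := lerP l n%:Z; first exact: IH.
  have -> : l = n%:Z + 1 by lia.
  have IHd (t : nat) : delays p t -> z (n%:Z - t%:Z) = w (n%:Z - t%:Z).
    by move=> /ub td; apply: IH; lia.
  have [||||ex ey] := @next_ext z w n.
  - by apply: IH; lia.
  - by apply: IHd; left.
  - by move=> i j; apply: IHd; right; exists (i, j) => //; left; exists n.
  - by move=> i j; apply: IHd; right; exists (i, j) => //; right; exists n.
  apply/colP => k; have [i ->|j ->] := split_ordP k.
    by have := (solz n).1 i; rewrite ex -(solw n).1.
  by have := (solz n).2 j; rewrite ey -(solw n).2.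
by move=> l ld; apply: (past `|l|%N) => //; lia.
Qed.

Lemma solution_from_ex (alpha : history p) :
  exists z, solution_from alpha z.
Proof.
pose z0 : trajectory R N1 N2 := fun l => col (inord `|l|%N) alpha.
pose next (z : trajectory R N1 N2) (m : nat) : 'cV[R]_(N1 + N2) :=
  col_mx (\col_i x_next p z i m) (\col_j y_next p z j m).
pose fix zs (n : nat) : trajectory R N1 N2 := if n is m.+1
  then fun l => if l == m.+1%:Z then next (zs m) m else zs m l
  else z0.
pose z : trajectory R N1 N2 := fun l => zs (if l is Posz n then n else 0%N) l.
have zsE n l : l <= n%:Z -> zs n l = z l.
  elim: n => [|n IH] ln; first by case: l ln => [[|l]|l].
  rewrite /=; case: eqP => [->|ne]; first by rewrite /z /= eqxx.
  by apply: IH; lia.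
exists z; split=> [m|].
  have [||||ex ey] := @next_ext (zs m) z m; try by move=> *; apply: zsE; lia.
  have -> : m%:Z + 1 = m.+1 by lia.
  split=> [i|j]; rewrite /xc /yc /z /= eqxx /next.
    by rewrite col_mxEu mxE ex.
  by rewrite col_mxEd mxE ey.
apply/matrixP => i k; rewrite mxE sub0r -(@zsE 0%N) /=; last by lia.
by rewrite mxE abszN /= inord_val.
Qed.

End Facts.

(* Main.v *)
Require Import Defs.
From HB Require Import structures.
From mathcomp Require Import all_boot all_order all_algebra.
From mathcomp Require Import all_classical all_reals all_analysis.
From mathcomp Require Import complex.
From mathcomp Require Import zify ring.
Import Order.TTheory GRing.Theory Num.Theory numFieldNormedType.Exports.
Local Open Scope classical_set_scope.
Local Open Scope ring_scope.

(** Write P = I - B for the matrix of the theorem and D for the largest delay.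
The argument compares the difference u of two solutions with an explicit
decaying function of the form K * zeta ^+ m * d.

The spectral hypothesis enters only through a vector d with positive entries
such that P d has positive entries ([nonsingular_M_matrix_gt0]), in other words
B d < d.  Such a d is found by following the solution of
(P + t) d(t) = det(P + t)^2 * (1, ..., 1), which Cramer's rule writes as a
polynomial in t, from large t down to t = 0.  No P + t with t >= 0 is singular,
since -t is not an eigenvalue of P.  For large t the matrix is diagonally
dominant and d(t) > 0.  If d(0) > 0 failed, the smallest entry of d(t) would
vanish at some t by the intermediate value theorem; then d(t) >= 0, and a
vanishing entry i would make row i of (P + t) d(t) nonpositive, because the
off-diagonal entries are nonpositive.

Since B d < d, there is zeta < 1 so close to 1 that B d <= zeta ^+ D.+1 * d
([exists_rate]).  The Lipschitz bounds turn the model into a delay inequality: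
whenever |u_j| <= M_j on the window m - D, ..., m for all j, one has
|u_i (m + 1)| <= (B M)_i ([solution_step_le]).  Used with M = K zeta ^+ m * d
(up to a shift by D), the choice of zeta absorbs the D + 1 steps between the
oldest value of the window and the new one, so that the bound K zeta ^+ m * d
propagates by induction ([delay_inequality_decay]). *)

(** * A positive vector for nonsingular M-matrices *)

(** If d_i = 0, only the off-diagonal terms A_ij d_j <= 0 remain in row i of
A d, which contradicts the positivity of that row. *)
Lemma nonneg_Zmx_preimage_gt0 (R : realType) (n : nat) (A : 'M[R]_n)
    (d : 'cV[R]_n) :
  (forall i j, i != j -> A i j <= 0) -> (forall i, 0 <= d i 0) ->
  (forall i, 0 < (A *m d) i 0) -> forall i, 0 < d i 0.
Proof.
move=> ZA d_ge0 Ad_gt0 i; rewrite lt0r d_ge0 andbT; apply/eqP => di0.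
have := Ad_gt0 i; rewrite ltNge => /negP; apply.
rewrite mxE; apply: sumr_le0 => j _.
have [<-|ij] := eqVneq i j; first by rewrite di0 mulr0.
by rewrite mulr_le0_ge0 ?ZA ?d_ge0.
Qed.

(** A minimum principle: at an index i where d is smallest, replacing every d_j
by d_i can only increase row i of A d, so d_i <= 0 would make that row
nonpositive. *)
Lemma dominant_Zmx_preimage_gt0 (R : realType) (n : nat) (A : 'M[R]_n)
    (d : 'cV[R]_n) :
  (forall i j, i != j -> A i j <= 0) -> (forall i, 0 <= \sum_j A i j) ->
  (forall i, 0 < (A *m d) i 0) -> forall i, 0 < d i 0.
Proof.
move=> ZA A_ge0 Ad_gt0 k.
have [i _ imin] := arg_minP (fun i => d i 0) (isT : xpredT k).
apply: lt_le_trans (imin k isT); rewrite ltNge; apply/negP => di_le0.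
have := Ad_gt0 i; rewrite ltNge => /negP; apply.
apply: (@le_trans _ _ (\sum_j A i j * d i 0)).
  rewrite mxE; apply: ler_sum => j _.
  have [<-//|ij] := eqVneq i j.
  by rewrite ler_wnM2l ?ZA ?imin.
by rewrite -mulr_suml mulr_ge0_le0.
Qed.

(** A kernel vector of A + t is an eigenvector of A for the real eigenvalue
- t, whose real part is not positive. *)
Lemma det_shift_neq0 (R : realType) (n : nat) (A : 'M[R]_n) (t : R) :
  (forall z : R[i], eigenvalue (map_mx (real_complex R) A) z ->
     0 < complex.Re z) ->
  0 <= t -> \det (A + t%:M) != 0.
Proof.
move=> spec t_ge0; apply/negP => /det0P[v v_neq0 vA].
have /spec /= : eigenvalue (map_mx (real_complex R) A) (real_complex R (- t)).
  rewrite eigenvalue_map; apply/eigenvalueP; exists v => //.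
  by apply/eqP; rewrite scaleNr -addr_eq0 -mul_mx_scalar -mulmxDr vA.
by rewrite oppr_gt0 ltNge t_ge0.
Qed.

(** The value 1 for the empty minimum also caps the minimum; only its sign
matters where this is applied. *)
Lemma continuous_bigmin (R : realType) (n : nat) (f : 'I_n -> R -> R) :
  (forall i, continuous (f i)) ->
  continuous (fun t => \big[Num.min/1]_i f i t).
Proof.
move=> f_cont; elim: (index_enum _) => [|i s IH] x.
  under eq_fun do rewrite big_nil.
  exact: cvg_cst.
under eq_fun do rewrite big_cons.
by apply: (@continuous_min _ _ (f i) _ x); [exact: f_cont|exact: IH].
Qed.

(** Semipositivity of nonsingular M-matrices, by the homotopy t |-> A + t
between A and a diagonally dominant matrix; the intermediate value theorem
applied to the smallest entry of d(t) replaces the Perron-Frobenius theorem. *)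
Lemma nonsingular_M_matrix_gt0 (R : realType) (n : nat) (A : 'M[R]_n) :
  nonsingular_M_matrix A ->
  exists d : 'cV[R]_n, (forall i, 0 < d i 0) /\ (forall i, 0 < (A *m d) i 0).
Proof.
move=> [ZA spec].
pose At (t : R) := A + t%:M.
have ZAt t i j : i != j -> At t i j <= 0.
  by move=> ij; rewrite !mxE (negbTE ij) mulr0n addr0 ZA.
(* The factor det (A + t) makes the right-hand side of
   (A + t) d(t) = det (A + t) ^+ 2 positive whatever the sign of the
   determinant, and keeps d polynomial in t. *)
pose d (t : R) : 'cV[R]_n := \det (At t) *: (\adj (At t) *m const_mx 1).
have Atd t i : 0 <= t -> 0 < (At t *m d t) i 0.
  move=> t_ge0; rewrite -scalemxAr mulmxA mul_mx_adj mul_scalar_mx scalerA mxE.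
  by rewrite mxE mulr1 -expr2 exprn_even_gt0 //= det_shift_neq0.
have d_cont i : continuous (fun t => d t i 0).
  (* Over {poly R}, the entries of d become evaluations of polynomials. *)
  pose AX : 'M[{poly R}]_n := map_mx polyC A + 'X%:M.
  have AXt t : map_mx (horner_eval t) AX = At t.
    apply/matrixP => k l; rewrite !mxE /= /horner_eval.
    by rewrite !hornerE hornerMn hornerX.
  pose q := \det AX * \sum_j \adj AX i j.
  have -> : (fun t => d t i 0) = horner q.
    apply/funext => t; rewrite /q hornerM /d mxE -AXt det_map_mx -map_mx_adj.
    congr (_ * _); rewrite mxE horner_sum.
    by apply: eq_bigr => j _; rewrite !mxE mulr1.
  exact: continuous_horner.
pose mind (t : R) := \big[Num.min/1]_i d t i 0.
have mind_le t i : mind t <= d t i 0 by apply: bigmin_le.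
have mind_cont : continuous mind := @continuous_bigmin _ _ _ d_cont.
(* At t = T every row sum of A + t is nonnegative. *)
pose T := \sum_i \sum_j `|A i j|.
have T_ge0 : 0 <= T by do 2!apply: sumr_ge0 => ? _.
have mindT : 0 < mind T.
  apply: lt_bigmin => // i _; move: i.
  apply: (@dominant_Zmx_preimage_gt0 _ _ (At T)) => [||i];
    [exact: ZAt| |exact: Atd].
  move=> i; under eq_bigr do rewrite !mxE.
  rewrite big_split /= [X in _ + X](bigD1 i) //= eqxx mulr1n.
  rewrite [X in _ + (_ + X)]big1 ?addr0; last first.
    by move=> j ji; rewrite eq_sym (negbTE ji).
  rewrite -lerBlDl sub0r -sumrN /T [leRHS](bigD1 i) //= ler_wpDr //.
    by do 2!apply: sumr_ge0 => ? _.
  by apply: ler_sum => j _; rewrite -normrN ler_norm.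
have mind0 : 0 < mind 0.
  rewrite ltNge; apply/negP => mind0.
  have [//||t] := @IVT R mind 0 T 0 T_ge0.
  - exact: continuous_subspaceT.
  - by rewrite ge_min mind0 le_max (ltW mindT) orbT.
  rewrite in_itv => /andP[t_ge0 _] mindt.
  (* At this t all entries of d(t) are nonnegative, hence positive, so their
     minimum cannot be 0. *)
  have : mind t <= 0 by rewrite mindt.
  apply/negP; rewrite -ltNge lt_bigmin // => i _; move: i.
  apply: (@nonneg_Zmx_preimage_gt0 _ _ (At t)) => i; first exact: ZAt.
    by rewrite -mindt mind_le.
  exact: Atd.
exists (d 0); split=> i; first exact: lt_le_trans mind0 _.
by have := @Atd 0 i (lexx _); rewrite /At raddf0 addr0.
Qed.

(** * Decay of solutions of a delay inequality *)

(** With kappa < 1 an upper bound of all the ratios b_i / d_i, zeta is the root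
of order D + 1 of kappa.  The seed 1 / 2 of the maximum keeps kappa, hence
zeta, positive. *)
Lemma exists_rate (R : realType) (n D : nat) (b d : 'I_n -> R) :
  (forall i, 0 < d i) -> (forall i, b i < d i) ->
  exists zeta : R, [/\ 0 < zeta, zeta < 1 &
    forall i, b i <= zeta ^+ D.+1 * d i].
Proof.
move=> d_gt0 bd.
pose kappa := \big[Num.max/2^-1]_i (b i / d i).
have kappa_gt0 : 0 < kappa.
  by apply: lt_le_trans (bigmax_ge_id _ _ _ _); rewrite invr_gt0.
have kappa_lt1 : kappa < 1.
  apply: bigmax_lt => [|i _]; first by rewrite invf_lt1 // ltr1n.
  by rewrite ltr_pdivrMr // mul1r.
have powK : (kappa `^ D.+1%:R^-1) ^+ D.+1 = kappa.
  rewrite -powR_mulrn ?powR_ge0 // -powRrM mulVf ?pnatr_eq0 //.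
  by rewrite powRr1 // ltW.
exists (kappa `^ D.+1%:R^-1); split=> [| |i].
- exact: powR_gt0.
- by rewrite -(@expr_lt1 _ D.+1) ?powR_ge0 // powK.
- by rewrite powK -ler_pdivrMr //; apply: le_bigmax.
Qed.

(** The delay inequality is stated through arbitrary bounds M of the window
m, ..., m + D, so that no maximum over the window is needed: it is used with
M = K * zeta ^+ m * d, which bounds the window because zeta < 1. *)
Lemma delay_inequality_decay (R : realType) (n D : nat) (B : 'M[R]_n)
    (d : 'cV[R]_n) (zeta K : R) (v : 'I_n -> nat -> R) :
  0 < zeta -> zeta < 1 -> 0 <= K -> (forall i, 0 < d i 0) ->
  (forall i, (B *m d) i 0 <= zeta ^+ D.+1 * d i 0) ->
  (forall i k, (k <= D)%N -> `|v i k| <= K * zeta ^+ k * d i 0) ->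
  (forall i m (M : 'cV[R]_n),
     (forall j k, (m <= k <= m + D)%N -> `|v j k| <= M j 0) ->
     `|v i (m + D.+1)%N| <= (B *m M) i 0) ->
  forall i k, `|v i k| <= K * zeta ^+ k * d i 0.
Proof.
move=> zeta_gt0 zeta_lt1 K_ge0 d_gt0 Bd ini step i k.
elim/ltn_ind: k i => k IH i.
have [/ini//|Dk] := leqP k D.
have Ek : (k = (k - D.+1) + D.+1)%N by rewrite subnK.
move: (k - D.+1)%N Ek => m Ek; rewrite {}Ek in IH *.
apply: le_trans (step i m ((K * zeta ^+ m) *: d) _) _ => [j l /andP[ml lD]|].
  apply: le_trans (IH l _ j) _; first by rewrite addnS ltnS.
  rewrite mxE; apply: ler_wpM2r; first exact: ltW.
  by rewrite ler_wpM2l // ler_wiXn2l // ltW.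
rewrite -scalemxAr mxE exprD -!mulrA; apply: ler_wpM2l => //.
by apply: ler_wpM2l => //; rewrite exprn_ge0 // ltW.
Qed.

(** * The model satisfies a delay inequality *)

Lemma norm_le_abs_sup (R : realType) (phi : nat -> R) (m : nat) :
  bounded_fun (phi : nat -> R^o) -> `|phi m| <= abs_sup phi.
Proof.
move=> [M [_ phiM]]; apply: ub_le_sup; last by exists m.
by exists (M + 1) => _ [k _ <-]; apply: phiM => //; rewrite ltrDl.
Qed.

(** The two layers of the model have the same form, so a single estimate serves
both: x is the leakage term, y and yd are the current and the delayed values of
the other layer, and the input J cancels in the difference. *)
Lemma layer_difference_le (R : realType) (n : nat) (c c' x x' Mx J : R)
    (a a' b b' F y y' yd yd' M : 'I_n -> R) (f : 'I_n -> R -> R) :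
  `|c| <= c' -> (forall j, `|a j| <= a' j) -> (forall j, `|b j| <= b' j) ->
  (forall j, (F j).-lipschitz (f j)) ->
  `|x - x'| <= Mx -> (forall j, `|y j - y' j| <= M j) ->
  (forall j, `|yd j - yd' j| <= M j) ->
  `|(c * x + \sum_j a j * f j (y j) + \sum_j b j * f j (yd j) + J) -
    (c * x' + \sum_j a j * f j (y' j) + \sum_j b j * f j (yd' j) + J)|
  <= c' * Mx + \sum_j (a' j + b' j) * F j * M j.
Proof.
move=> cc' aa' bb' f_lip xM yM ydM.
(* A Lipschitz constant on the whole line is nonnegative: compare f at 1 and
   at 0. *)
have F_ge0 j : 0 <= F j.
  have := f_lip j (1, 0) (conj I I) => /= /(le_trans (normr_ge0 _)).
  by rewrite subr0 normr1 mulr1.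
have term (e e' : 'I_n -> R) (s s' : 'I_n -> R) :
    (forall j, `|e j| <= e' j) -> (forall j, `|s j - s' j| <= M j) ->
    `|\sum_j e j * f j (s j) - \sum_j e j * f j (s' j)|
    <= \sum_j e' j * (F j * M j).
  move=> ee' sM; rewrite -sumrB; apply: le_trans (ler_norm_sum _ _ _) _.
  apply: ler_sum => j _; rewrite -mulrBr normrM ler_pM //.
  apply: le_trans (f_lip j (s j, s' j) (conj I I)) _.
  by rewrite /= ler_wpM2l.
under [X in _ <= _ + X]eq_bigr do rewrite -mulrA mulrDl.
rewrite big_split /=.
set A := \sum_j _; set A2 := \sum_j _; set B := \sum_j _; set B2 := \sum_j _.
have -> : c * x + A + A2 + J - (c * x' + B + B2 + J) =
  c * (x - x') + ((A - B) + (A2 - B2)) by ring.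
apply: le_trans (ler_normD _ _) _; rewrite normrM; apply: lerD.
  exact: ler_pM.
by apply: le_trans (ler_normD _ _) _; apply: lerD; apply: term.
Qed.

(** [1%:M - bam_mx p F G] is the nonnegative matrix B of gains; its rows are
exactly the right-hand sides produced by [layer_difference_le]. *)
Lemma gain_mxEu (R : realType) (N1 N2 : nat) (p : bam R N1 N2)
    (F : 'I_N2 -> R) (G : 'I_N1 -> R) (M : 'cV[R]_(N1 + N2)) (i : 'I_N1) :
  ((1%:M - bam_mx p F G) *m M) (lshift N2 i) 0 =
  abs_sup (hc p i) * M (lshift N2 i) 0 +
  \sum_j (abs_sup (ha p i j) + abs_sup (hb p i j)) * F j * M (rshift N1 j) 0.
Proof.
rewrite -[M in LHS]vsubmxK /bam_mx (@scalar_mx_block _ N1 N2 1) opp_block_mx.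
rewrite add_block_mx mul_block_col col_mxEu !opprB !addrA !sub0r !opprK.
rewrite ![1%:M + _]addrC !addrK mul_diag_mx !mxE.
by congr (_ + _); apply: eq_bigr => j _; rewrite !mxE.
Qed.

Lemma gain_mxEd (R : realType) (N1 N2 : nat) (p : bam R N1 N2)
    (F : 'I_N2 -> R) (G : 'I_N1 -> R) (M : 'cV[R]_(N1 + N2)) (j : 'I_N2) :
  ((1%:M - bam_mx p F G) *m M) (rshift N1 j) 0 =
  abs_sup (tc p j) * M (rshift N1 j) 0 +
  \sum_i (abs_sup (ta p j i) + abs_sup (tb p j i)) * G i * M (lshift N2 i) 0.
Proof.
rewrite -[M in LHS]vsubmxK /bam_mx (@scalar_mx_block _ N1 N2 1) opp_block_mx.
rewrite add_block_mx mul_block_col col_mxEd !opprB !addrA !sub0r !opprK.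
rewrite ![1%:M + _]addrC !addrK mul_diag_mx addrC !mxE.
by congr (_ + _); apply: eq_bigr => i _; rewrite !mxE.
Qed.

Lemma bounded_fun_lt1 (R : realType) (phi : nat -> R) :
  (forall m, -1 < phi m < 1) -> bounded_fun (phi : nat -> R^o).
Proof.
move=> phi1; exists 1; split=> // M M1 m _ /=.
rewrite (le_trans _ (ltW M1)) // ler_norml.
by case/andP: (phi1 m) => /ltW-> /ltW->.
Qed.

(** All values read at time m lie in the window m - max_delay, ..., m, which is
what lets one bound M control the leakage, current and delayed terms. *)
Lemma solution_step_le (R : realType) (N1 N2 : nat) (p : bam R N1 N2)
    (F : 'I_N2 -> R) (G : 'I_N1 -> R)
    (hc_range : forall i m, -1 < hc p i m < 1)
    (tc_range : forall j m, -1 < tc p j m < 1)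
    (ha_bounded : forall i j, bounded_fun (ha p i j))
    (ta_bounded : forall j i, bounded_fun (ta p j i))
    (hb_bounded : forall i j, bounded_fun (hb p i j))
    (tb_bounded : forall j i, bounded_fun (tb p j i))
    (tau_bounded : delays_bounded p)
    (f_lipschitz : forall j, (F j).-lipschitz (f_ p j))
    (g_lipschitz : forall i, (G i).-lipschitz (g_ p i))
    (z w : trajectory R N1 N2) (m : nat) (M : 'cV[R]_(N1 + N2)) :
  is_solution p z -> is_solution p w ->
  (forall i k, (k <= max_delay p)%N ->
     `|z (m%:Z - k%:Z) i 0 - w (m%:Z - k%:Z) i 0| <= M i 0) ->
  forall i, `|z (m%:Z + 1) i 0 - w (m%:Z + 1) i 0|
            <= ((1%:M - bam_mx p F G) *m M) i 0.
Proof.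
move=> solz solw zwM i; have [_ delay_le] := max_delayP tau_bounded.
have zwM0 k : `|z m%:Z k 0 - w m%:Z k 0| <= M k 0.
  by have := zwM k 0%N (leq0n _); rewrite subr0.
have [zx zy] := solz m; have [wx wy] := solw m.
have [i1 ->|i2 ->] := split_ordP i.
  rewrite gain_mxEu; have := zx i1; have := wx i1.
  rewrite /xc /x_next => -> ->.
  apply: layer_difference_le => // [|j|j||j|j].
  - by apply: norm_le_abs_sup; apply: bounded_fun_lt1.
  - exact: norm_le_abs_sup.
  - exact: norm_le_abs_sup.
  - by apply: zwM; apply: delay_le; left.
  - exact: zwM0.
  - by apply: zwM; apply: delay_le; right; exists (i1, j) => //; left; exists m.
rewrite gain_mxEd; have := zy i2; have := wy i2.
rewrite /yc /y_next => -> ->.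
apply: layer_difference_le => // [|j|j||j|j].
- by apply: norm_le_abs_sup; apply: bounded_fun_lt1.
- exact: norm_le_abs_sup.
- exact: norm_le_abs_sup.
- by apply: zwM; apply: delay_le; left.
- exact: zwM0.
- by apply: zwM; apply: delay_le; right; exists (j, i2) => //; right; exists m.
Qed.

(** * Exponential stability *)

Lemma mx_norm_coord_le (R : realType) (m n : nat) (A : 'M[R]_(m, n)) i j :
  `|A i j| <= `|A|.
Proof.
rewrite [leRHS]/Num.Def.normr /= mx_normrE.
by apply/bigmax_geP; right; exists (i, j).
Qed.

Lemma mx_norm_le (R : realType) (m n : nat) (A : 'M[R]_(m, n)) (c : R) :
  0 <= c -> (forall i j, `|A i j| <= c) -> `|A| <= c.
Proof.
move=> c_ge0 Ac; rewrite [leLHS]/Num.Def.normr /= mx_normrE.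
by apply: bigmax_le => // ij _.
Qed.

Theorem theorem6 (R : realType) (N1 N2 : nat)
    (N1_gt0 : (0 < N1)%N) (N2_gt0 : (0 < N2)%N)
    (p : bam R N1 N2) (F : 'I_N2 -> R) (G : 'I_N1 -> R)
    (hc_range : forall i m, -1 < hc p i m < 1)
    (tc_range : forall j m, -1 < tc p j m < 1)
    (ha_bounded : forall i j, bounded_fun (ha p i j))
    (ta_bounded : forall j i, bounded_fun (ta p j i))
    (hb_bounded : forall i j, bounded_fun (hb p i j))
    (tb_bounded : forall j i, bounded_fun (tb p j i))
    (tau_bounded : delays_bounded p)
    (f_lipschitz : forall j, (F j).-lipschitz (f_ p j))
    (g_lipschitz : forall i, (G i).-lipschitz (g_ p i)) :
  nonsingular_M_matrix (bam_mx p F G) -> globally_exponentially_stable p.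
Proof.
move=> /nonsingular_M_matrix_gt0[d [d_gt0 Pd_gt0]].
set D := max_delay p.
have [|zeta [zeta_gt0 zeta_lt1 Bd]] :=
    @exists_rate _ _ D (fun i => ((1%:M - bam_mx p F G) *m d) i 0) _ d_gt0.
  by move=> i; rewrite mulmxBl mul1mx mxE [X in _ + X]mxE gtrBl.
pose dmin := \big[Num.min/1]_i d i 0.
pose dmax := \big[Num.max/1]_i d i 0.
have dmin_gt0 : 0 < dmin by apply: lt_bigmin.
have dmax_gt0 : 0 < dmax by apply: lt_le_trans (bigmax_ge_id _ _ _ _).
(* The factors dmin and dmax convert the norm weighted by d into the maximum
   norm; zeta ^+ D pays for the D time steps spanned by a segment. *)
exists (dmax / (dmin * zeta ^+ D)), zeta; split=> //.
  by rewrite divr_gt0 ?mulr_gt0 ?exprn_gt0.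
move=> alpha beta z w [solz z0] [solw w0] m.
pose K := `|alpha - beta| / (dmin * zeta ^+ D).
have K_ge0 : 0 <= K by rewrite divr_ge0 // ltW // mulr_gt0 ?exprn_gt0.
(* Shifting time by D lets the induction run over natural numbers: the initial
   history occupies the indices 0, ..., D. *)
pose v (i : 'I_(N1 + N2)) (k : nat) : R :=
  z (k%:Z - D%:Z) i 0 - w (k%:Z - D%:Z) i 0.
have decay : forall i k, `|v i k| <= K * zeta ^+ k * d i 0.
  apply: (@delay_inequality_decay _ _ D (1%:M - bam_mx p F G)) => // [i k kD|].
    have lk : (D - k < D.+1)%N by rewrite ltnS leq_subr.
    have -> : v i k = (alpha - beta) i (Ordinal lk).
      rewrite -z0 -w0 !mxE /v.
      by have -> : k%:Z - D%:Z = 0%:Z - (D - k)%:Z by lia.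
    apply: le_trans (mx_norm_coord_le _ _ _ _ _ _) _.
    (* On the initial history, K * zeta ^+ k * d_i is at least the norm of
       alpha - beta because k <= D and dmin <= d_i. *)
    have zk : zeta ^+ D <= zeta ^+ k by apply: ler_wiXn2l => //; exact: ltW.
    have dk : dmin <= d i 0 by apply: bigmin_le.
    rewrite /K -mulrA mulrAC -mulrA ler_peMr // ler_pdivlMr.
      by rewrite mul1r [leRHS]mulrC ler_pM // ltW // exprn_gt0.
    by rewrite mulr_gt0 ?exprn_gt0.
  move=> i l M vM.
  have -> : v i (l + D.+1)%N = z (l%:Z + 1) i 0 - w (l%:Z + 1) i 0.
    by rewrite /v; have -> : (l + D.+1)%:Z - D%:Z = l%:Z + 1 by lia.
  apply: solution_step_le => // j k kD.
  have := vM j (l + D - k)%N; rewrite /v.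
  have -> : (l + D - k)%:Z - D%:Z = l%:Z - k%:Z.
    by rewrite -/D in kD *; lia.
  by apply; rewrite -/D in kD *; lia.
have -> : dmax / (dmin * zeta ^+ D) * zeta ^+ m * `|alpha - beta|
          = K * zeta ^+ m * dmax by rewrite /K; ring.
apply: mx_norm_le => [|i k].
  by apply: mulr_ge0; [apply: mulr_ge0 => //; apply: exprn_ge0|]; exact: ltW.
have kD : (k <= D)%N by rewrite -ltnS.
have -> : (segment p z m - segment p w m) i k = v i (m + (D - k))%N.
  rewrite !mxE /v.
  by have -> : (m + (D - k))%:Z - D%:Z = m%:Z - k%:Z by lia.
apply: le_trans (decay _ _) _.
apply: ler_pM => //; [|exact: ltW| |].
- by apply: mulr_ge0 => //; apply: exprn_ge0; exact: ltW.
- by apply: ler_wpM2l => //; apply: ler_wiXn2l; rewrite ?leq_addr // ltW.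
- exact: (le_bigmax _ (fun k => d k 0)).
Qed.
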